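(* Let $n\in\mathbb N$, $\alpha>0$, $1<p<\infty$ and $\frac1p+\frac1{p'}=1$. For nonzero $g\in\mathcal{H}^n_{p,\alpha}$ and nonzero $h\in\mathcal{H}^n_{p',\alpha}$ set \[ \mathcal{R}_{p,\alpha}(g,h)=\frac{|\langle g,h\rangle_\alpha|}{\|g\|_{p,\alpha}\|h\|_{p',\alpha}}. \] Then \[ C_p^{n/2}\le \sup_{g\in\mathcal{H}^n_{p,\alpha}\setminus\{0\}}\ \sup_{h\in\mathcal{H}^n_{p',\alpha}\setminus\{0\}}\mathcal{R}_{p,\alpha}(g,h)\le C_p^n. \]
   Context: For $\alpha>0$ and $n\in\mathbb N$, $\gamma^n_\alpha(dz)=(\alpha/\pi)^n e^{-\alpha|z|^2}\lambda^n(dz)$ on $\mathbb C^n$, with $\lambda^n$ Lebesgue measure. For $1\le p<\infty$, $\mathcal{H}^n_{p,\alpha}$ is the space of holomorphic $f$ on $\mathbb C^n$ with $\|f\|_{p,\alpha}:=\left(\int|f|^p\,d\gamma^n_{\alpha p/2}\right)^{1/p}<\infty$. $\langle f,g\rangle_\alpha=\int f\overline{g}\,d\gamma^n_\alpha$. $C_p=2\,p^{-1/p}\,(p')^{-1/p'}$. *)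

(* Defs.v *)
From HB Require Import structures.
From mathcomp Require Import all_boot all_order all_algebra.
From mathcomp Require Import all_classical all_reals all_analysis.
From mathcomp Require Import complex.
Import Order.TTheory GRing.Theory Num.Theory.
Local Open Scope classical_set_scope.
Local Open Scope ring_scope.

(* Points of C are represented, for measure-theoretic purposes, by pairs
   (x, y) : R * R (the point x + i y); C^n by n-tuples of such pairs.
   [toC] / [rowC] transport them to the complex field R[i] and to the
   complex vector space 'rV[R[i]]_n, where holomorphy is defined. *)

Definition toC (R : realType) (p : (R * R)%type) : R[i] := Complex p.1 p.2.

Definition rowC (R : realType) (n : nat) (t : n.-tuple (R * R)%type)
  : 'rV[R[i]]_n := \row_j toC R (tnth t j).

Definition lebC (R : realType) : set (R * R)%type -> \bar R :=
  (@lebesgue_measure R \x @lebesgue_measure R)%E.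

Fixpoint lebCn (R : realType) (n : nat) : set (n.-tuple (R * R)%type) -> \bar R :=
  match n return set (n.-tuple (R * R)%type) -> \bar R with
  | 0 => \d_ [tuple]
  | m.+1 => pushforward (lebC R \x lebCn R m)%E
              (fun zw : ((R * R) * m.-tuple (R * R))%type =>
                 [tuple of zw.1 :: zw.2])
  end.

Definition sqnorm (R : realType) (n : nat) (t : n.-tuple (R * R)%type) : R :=
  \sum_(j < n) ((tnth t j).1 ^+ 2 + (tnth t j).2 ^+ 2).

Definition gaussCn (R : realType) (n : nat) (alpha : R)
  : set (n.-tuple (R * R)%type) -> \bar R :=
  fun A => (\int[lebCn R n]_(t in A)
              ((alpha / pi) ^+ n * expR (- alpha * sqnorm R n t))%:E)%E.

(* holomorphic functions on C^n: complex (Frechet) differentiable at every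
   point, the derivative being R[i]-linear *)
Definition holomorphic (R : realType) (n : nat) (f : 'rV[R[i]]_n -> R[i]) : Prop :=
  forall z, differentiable (f : 'rV[R[i]]_n -> (R[i])^o) z.

Definition pint (R : realType) (n : nat) (p alpha : R) (f : 'rV[R[i]]_n -> R[i])
  : \bar R :=
  (\int[gaussCn R n (alpha * p / 2)]_t ((ComplexField.Normc.normc (f (rowC R n t))) `^ p)%:E)%E.

Definition Hspace (R : realType) (n : nat) (p alpha : R) : set ('rV[R[i]]_n -> R[i]) :=
  [set f | holomorphic R n f /\ (pint R n p alpha f < +oo)%E].

Definition pnorm (R : realType) (n : nat) (p alpha : R) (f : 'rV[R[i]]_n -> R[i]) : R :=
  (fine (pint R n p alpha f)) `^ (p^-1).

Definition inner (R : realType) (n : nat) (alpha : R) (f g : 'rV[R[i]]_n -> R[i]) : R[i] :=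
  Complex
    (fine (\int[gaussCn R n alpha]_t
       (complex.Re (f (rowC R n t) * conjc (g (rowC R n t))))%:E)%E)
    (fine (\int[gaussCn R n alpha]_t
       (complex.Im (f (rowC R n t) * conjc (g (rowC R n t))))%:E)%E).

Definition ratio (R : realType) (n : nat) (p p' alpha : R) (g h : 'rV[R[i]]_n -> R[i]) : R :=
  ComplexField.Normc.normc (inner R n alpha g h) / (pnorm R n p alpha g * pnorm R n p' alpha h).

Definition Cp (R : realType) (p p' : R) : R :=
  2 * p `^ (- p^-1) * p' `^ (- p'^-1).

Definition ratios (R : realType) (n : nat) (p p' alpha : R) : set R :=
  [set r | exists g h, [/\ g \in Hspace R n p alpha, g <> (fun=> 0),
      h \in Hspace R n p' alpha, h <> (fun=> 0) & r = ratio R n p p' alpha g h]].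

(* Main.v *)
Require Import Defs.
From HB Require Import structures.
From mathcomp Require Import all_boot all_order all_algebra.
From mathcomp Require Import all_classical all_reals all_analysis.
From mathcomp Require Import measurable_realfun complex ring lra.
Import Order.TTheory GRing.Theory Num.Theory.
Import numFieldNormedType.Exports.
Local Open Scope classical_set_scope.
Local Open Scope ring_scope.
Set Implicit Arguments.
Unset Strict Implicit.
Unset Printing Implicit Defensive.

(* Upper bound: |<g, h>| <= int |g| |h| d(gamma_alpha), and Hoelder's inequality
   for Lebesgue measure, applied to |g| exp(-alpha |z|^2 / 2) and
   |h| exp(-alpha |z|^2 / 2), gives the constant Cp^n once the normalisations of
   the three Gaussian measures are collected.

   Lower bound: take g = exp(alpha s (z_1^2 + ... + z_n^2) / 2) and h the same
   function with r in place of s, where s = 1 - d^2 / p, r = 1 - d^2 / p' and d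
   tends to 0.  The norms of g and h are explicit Gaussian integrals.  The real
   part of g * conj h is a Gaussian times cos u, where u is alpha (s - r) times
   the sum of the x_j y_j.  Since cos u >= 2 - exp |u| and |u| is bounded by a
   small diagonal quadratic form, the oscillation is negligible and the pairing is
   bounded below by Gaussian integrals again; the ratio is at least
   (2 (1 - d)^n - 1) Cp^(n/2). *)

Local Notation normc := (@ComplexField.Normc.normc _).

Section complex_modulus.
Context (R : rcfType).
Implicit Types (a b r : R) (z w : R[i]).

Lemma normc_ge0 z : 0 <= normc z.
Proof. by case: z => a b; exact: sqrtr_ge0. Qed.

Lemma normr_complexE z : `|z| = ((normc z)%:C)%C.
Proof. by []. Qed.

Lemma ler_normc_Re z : `|complex.Re z| <= normc z.
Proof. by rewrite -lecR; exact: normc_ge_Re. Qed.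

Lemma ler_normc_Im z : `|complex.Im z| <= normc z.
Proof. by case: z => a b /=; rewrite -sqrtr_sqr ler_wsqrtr// lerDr sqr_ge0. Qed.

Lemma ler_normc_Complex a b : normc (Complex a b) <= `|a| + `|b|.
Proof.
have := le_normcD (Complex a 0) (Complex 0 b).
by rewrite /= expr0n/= addr0 !add0r addr0 !sqrtr_sqr.
Qed.

Lemma normc_conjc z : normc (conjc z) = normc z.
Proof. by case: z => a b /=; rewrite sqrrN. Qed.

Lemma ler_dist_normc z w : `|normc z - normc w| <= normc (z - w).
Proof. by have := @ler_dist_dist _ (Rcomplex R) z w. Qed.

Lemma gt0_complexP z : 0 < z -> exists2 r, 0 < r & z = (r%:C)%C.
Proof. by case: z => a b; rewrite ltcE /= => /andP[/eqP-> a0]; exists a. Qed.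

End complex_modulus.

(** * Densities and Lebesgue measure on C^n *)

Section density.
Local Open Scope ereal_scope.
Context (d : measure_display) (T : measurableType d) (R : realType).
Variables (mu : {measure set T -> \bar R}) (w : T -> R).
Hypotheses (w0 : forall x, (0 <= w x)%R) (mw : measurable_fun setT w).

Definition density (A : set T) : \bar R := \int[mu]_(x in A) (w x)%:E.

Let density0 : density set0 = 0.
Proof. by rewrite /density integral_set0. Qed.

Let density_ge0 A : 0 <= density A.
Proof. by apply: integral_ge0 => x _; rewrite lee_fin. Qed.

Let density_semi_sigma_additive : semi_sigma_additive density.
Proof.
move=> A mA tA mUA; rewrite /density ge0_integral_bigcup//=.
- by apply: is_cvg_ereal_nneg_natsum_cond => k _ _; exact: density_ge0.
- by apply: measurable_funTS; exact/measurable_EFinP.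
- by move=> x _; rewrite lee_fin.
Qed.

HB.instance Definition _ := isMeasure.Build _ _ _ density
  density0 density_ge0 density_semi_sigma_additive.

Definition density_measure : {measure set T -> \bar R} := density.

Lemma integral_density_indic (A : set T) : measurable A ->
  \int[density]_x (\1_A x)%:E = \int[mu]_x (\1_A x * w x)%:E.
Proof.
move=> mA; rewrite integral_indic// setIT /density [LHS]integral_mkcond.
by apply: eq_integral => x _; rewrite patchE indicE; case: ifPn; rewrite ?mul1r ?mul0r.
Qed.

Import HBNNSimple.

Lemma integral_density_nnsfun (h : {nnsfun T >-> R}) :
  \int[density]_x (h x)%:E = \int[mu]_x (h x * w x)%:E.
Proof.
pose term r x : \bar R := (r * \1_(h @^-1` [set r]) x)%:E.
have hE x : (h x)%:E = \sum_(r \in range h) term r x by rewrite fimfunE -fsumEFin.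
have term_ge0 r x : 0 <= term r x by exact: nnfun_muleindic_ge0.
have mterm r : measurable_fun setT (term r) by exact/measurable_EFinP/measurable_funM.
transitivity (\int[mu]_x \sum_(r \in range h) term r x * (w x)%:E); last first.
  by apply: eq_integral => x _; rewrite EFinM hE ge0_mule_fsuml.
under [LHS]eq_integral do rewrite hE.
rewrite !ge0_integral_fsum//; last 2 first.
- by move=> r; apply: emeasurable_funM => //; exact/measurable_EFinP.
- by move=> r x _; apply: mule_ge0 => //; rewrite lee_fin.
apply: eq_fsbigr => r; rewrite inE => -[x0 _ <-].
under [LHS]eq_integral do rewrite /term EFinM.
under [RHS]eq_integral do rewrite /term -EFinM -mulrA EFinM.
rewrite !ge0_integralZl ?lee_fin//.
- by rewrite integral_density_indic.
- by apply/measurable_EFinP/measurable_funM => //; exact: measurable_indic.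
- by move=> x _; rewrite lee_fin mulr_ge0.
- by apply/measurable_EFinP; exact: measurable_indic.
Qed.

Lemma ge0_integral_density (f : T -> \bar R) :
  measurable_fun setT f -> (forall x, 0 <= f x) ->
  \int[density]_x f x = \int[mu]_x (f x * (w x)%:E).
Proof.
move=> mf f0; pose h := nnsfun_approx measurableT mf.
have hf x : (h n x)%:E @[n --> \oo] --> f x by exact: cvg_nnsfun_approx.
have ndh x (a b : nat) : (a <= b)%N -> (h a x <= h b x)%R.
  by move=> ab; exact/lefP/nd_nnsfun_approx.
transitivity (\int[density]_x lim ((h n x)%:E @[n --> \oo])).
  by apply: eq_integral => x _; apply/esym/cvg_lim => //; exact: hf.
rewrite monotone_convergence//; first last.
- by move=> x _ a b ab; rewrite lee_fin ndh.
- by move=> n x _; rewrite lee_fin.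
- by move=> n; exact/measurable_EFinP.
under eq_fun do rewrite integral_density_nnsfun.
rewrite -monotone_convergence//; first last.
- by move=> x _ a b ab; rewrite lee_fin ler_wpM2r// ndh.
- by move=> n x _; rewrite lee_fin mulr_ge0.
- by move=> n; apply/measurable_EFinP/measurable_funM.
apply: eq_integral => x _; apply/cvg_lim => //.
by under eq_fun do rewrite EFinM; apply: cvgeZr.
Qed.

Lemma integral_density (f : T -> R) : measurable_fun setT f ->
  \int[density]_x (f x)%:E = \int[mu]_x (f x * w x)%:E.
Proof.
move=> mf; have mfE : measurable_fun setT (EFin \o f) by exact/measurable_EFinP.
rewrite [LHS]integralE [RHS]integralE; congr (_ - _).
  rewrite ge0_integral_density//; last exact: measurable_funepos.
  by apply: eq_integral => x _; rewrite !funeposE /= EFinM maxe_pMl ?lee_fin// mul0e.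
rewrite ge0_integral_density//; last exact: measurable_funeneg.
apply: eq_integral => x _; rewrite !funenegE /= -mulNr EFinM.
by rewrite maxe_pMl ?lee_fin// mul0e.
Qed.

End density.

Section product_sigma_finite_measure.
Local Open Scope ereal_scope.
Context d1 d2 (T1 : measurableType d1) (T2 : measurableType d2) (R : realType).
Variables (m1 : {sigma_finite_measure set T1 -> \bar R})
  (m2 : {sigma_finite_measure set T2 -> \bar R}).

Let prod := m1 \x m2.

HB.instance Definition _ := Measure.on prod.

Let prod_sigma_finite : sigma_finite setT prod.
Proof.
have /sigma_finiteP[A [TA ndA Aoo]] := sigma_finiteT m1.
have /sigma_finiteP[B [TB ndB Boo]] := sigma_finiteT m2.
exists (fun k => A k `*` B k) => [|k].
  apply/esym; rewrite -subTset => -[x y] _.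
  have [i _ Aix] : (\bigcup_k A k) x by rewrite -TA.
  have [j _ Bjy] : (\bigcup_k B k) y by rewrite -TB.
  exists (maxn i j) => //; split.
    by move: x Aix; exact/subsetPset/ndA/leq_maxl.
  by move: y Bjy; exact/subsetPset/ndB/leq_maxr.
have [mA Ak] := Aoo k; have [mB Bk] := Boo k.
split; first exact: measurableX.
by rewrite /prod product_measure1E// lte_mul_pinfty// ge0_fin_numE.
Qed.

HB.instance Definition _ := Measure_isSigmaFinite.Build _ _ _ prod prod_sigma_finite.

Definition product_sigma_finite_measure :
  {sigma_finite_measure set (T1 * T2)%type -> \bar R} := prod.

End product_sigma_finite_measure.

Section pushforward_sigma_finite_measure.
Local Open Scope ereal_scope.
Context d1 d2 (T1 : measurableType d1) (T2 : measurableType d2) (R : realType).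
Variables (mu : {sigma_finite_measure set T1 -> \bar R}) (f : T1 -> T2) (g : T2 -> T1).
Hypotheses (mf : measurable_fun setT f) (mg : measurable_fun setT g) (fK : cancel f g).

Let image := pushforward mu f.

Let image0 : image set0 = 0. Proof. exact: measure0. Qed.

Let image_ge0 A : 0 <= image A. Proof. exact: measure_ge0. Qed.

Let image_semi_sigma_additive : semi_sigma_additive image.
Proof. exact: measure_semi_sigma_additive. Qed.

HB.instance Definition _ := isMeasure.Build _ _ _ image
  image0 image_ge0 image_semi_sigma_additive.

Let image_sigma_finite : sigma_finite setT image.
Proof.
have [A TA Aoo] := sigma_finiteT mu; exists (fun k => g @^-1` A k).
  by rewrite -preimage_bigcup -TA preimage_setT.
move=> k; have [mA Ak] := Aoo k; split; first by rewrite -[_ @^-1` _]setTI; exact: mg.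
rewrite /image /pushforward -comp_preimage (_ : g \o f = id) ?preimage_id//.
exact/funext.
Qed.

HB.instance Definition _ := Measure_isSigmaFinite.Build _ _ _ image image_sigma_finite.

Definition pushforward_sigma_finite_measure :
  {sigma_finite_measure set T2 -> \bar R} := image.

End pushforward_sigma_finite_measure.

Section lebesgue_measure_C.
Context (R : realType).
Local Open Scope ereal_scope.
Local Notation leb := (@lebesgue_measure R).
Local Notation leb2 := (product_sigma_finite_measure leb leb).

Let lebC0 : lebC R set0 = 0. Proof. exact: (measure0 leb2). Qed.

Let lebC_ge0 A : 0 <= lebC R A. Proof. exact: (measure_ge0 leb2). Qed.

Let lebC_semi_sigma_additive : semi_sigma_additive (lebC R).
Proof. exact: (@measure_semi_sigma_additive _ _ _ leb2). Qed.

HB.instance Definition _ := isMeasure.Build _ _ _ (lebC R)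
  lebC0 lebC_ge0 lebC_semi_sigma_additive.

Let lebC_sigma_finite : sigma_finite setT (lebC R).
Proof. exact: (sigma_finiteT leb2). Qed.

HB.instance Definition _ :=
  Measure_isSigmaFinite.Build _ _ _ (lebC R) lebC_sigma_finite.

(* [R * R] and the domain of [leb2] have the same measurable sets but different
   displays: [lebC R] is the pushforward of [leb2] by the identity. *)
Lemma ge0_integral_lebC (f : R * R -> \bar R) :
  measurable_fun setT f -> (forall z, 0 <= f z) ->
  \int[lebC R]_z f z = \int[leb]_x \int[leb]_y f (x, y).
Proof.
move=> mf f0; rewrite -[lebC R]/(pushforward leb2 (id : _ -> (R * R)%type)).
by rewrite ge0_integral_pushforward// preimage_setT fubini_tonelli1.
Qed.

End lebesgue_measure_C.

Section lebesgue_measure_Cn.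
Context (R : realType).
Local Open Scope ereal_scope.
Local Notation R2 := (R * R)%type.

Definition cons_tuple_pair n (zw : (R2 * n.-tuple R2)%type) : n.+1.-tuple R2 :=
  [tuple of zw.1 :: zw.2].

Definition thead_behead n (t : n.+1.-tuple R2) : (R2 * n.-tuple R2)%type :=
  (thead t, [tuple of behead t]).

Lemma measurable_cons_tuple_pair n : measurable_fun setT (@cons_tuple_pair n).
Proof. exact: (measurable_cons measurable_fst measurable_snd). Qed.

Lemma measurable_thead_behead n : measurable_fun setT (@thead_behead n).
Proof.
apply/measurable_fun_pairP; split; first exact: measurable_tnth.
exact: measurable_behead.
Qed.

Lemma cons_tuple_pairK n : cancel (@cons_tuple_pair n) (@thead_behead n).
Proof. by case=> z w; rewrite /thead_behead theadE; congr (_, _); exact/val_inj. Qed.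

Lemma lebCn_sigma_finite_measure n :
  exists mu : {sigma_finite_measure set (n.-tuple R2) -> \bar R},
    (mu : set _ -> _) = lebCn R n.
Proof.
elim: n => [|n [mu muE]]; first by exists (\d_ [tuple]).
exists (pushforward_sigma_finite_measure (product_sigma_finite_measure (lebC R) mu)
  (@measurable_cons_tuple_pair n) (@measurable_thead_behead n) (@cons_tuple_pairK n)).
by rewrite /= -muE.
Qed.

Section lebCn_measure.
Variable n : nat.

Let lebCn0 : lebCn R n set0 = 0.
Proof. by have [mu <-] := lebCn_sigma_finite_measure n. Qed.

Let lebCn_ge0 A : 0 <= lebCn R n A.
Proof. by have [mu <-] := lebCn_sigma_finite_measure n. Qed.

Let lebCn_semi_sigma_additive : semi_sigma_additive (lebCn R n).
Proof.
by have [mu <-] := lebCn_sigma_finite_measure n; exact: measure_semi_sigma_additive.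
Qed.

HB.instance Definition _ := isMeasure.Build _ _ _ (lebCn R n)
  lebCn0 lebCn_ge0 lebCn_semi_sigma_additive.

Let lebCn_sigma_finite : sigma_finite setT (lebCn R n).
Proof. by have [mu <-] := lebCn_sigma_finite_measure n; exact: sigma_finiteT. Qed.

HB.instance Definition _ :=
  Measure_isSigmaFinite.Build _ _ _ (lebCn R n) lebCn_sigma_finite.

End lebCn_measure.

Lemma ge0_integral_lebCnS n (f : n.+1.-tuple R2 -> \bar R) :
  measurable_fun setT f -> (forall t, 0 <= f t) ->
  \int[lebCn R n.+1]_t f t = \int[lebC R]_z \int[lebCn R n]_w f [tuple of z :: w].
Proof.
move=> mf f0 /=.
rewrite (ge0_integral_pushforward (@measurable_cons_tuple_pair n))//=.
rewrite preimage_setT fubini_tonelli1//.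
exact: (measurableT_comp mf (@measurable_cons_tuple_pair n)).
Qed.

Lemma ge0_integral_lebCn_prod n (f : R2 -> R) (c : R) :
  measurable_fun setT f -> (forall z, (0 <= f z)%R) ->
  \int[lebC R]_z (f z)%:E = c%:E ->
  \int[lebCn R n]_t (\prod_(j < n) f (tnth t j))%:E = (c ^+ n)%:E.
Proof.
move=> mf f0 fc; elim: n => [|n IH].
  rewrite (eq_integral (cst 1)) => [|t _]; last by rewrite big_ord0.
  by rewrite /= integral_cst//= mul1e expr0 /dirac indicE in_setT.
have mprod k :
    measurable_fun setT (fun t : k.-tuple R2 => (\prod_(j < k) f (tnth t j))%:E).
  apply/measurable_EFinP/measurable_prod => j _.
  exact: measurableT_comp mf (measurable_tnth j).
have prod0 k (t : k.-tuple R2) : 0 <= (\prod_(j < k) f (tnth t j))%:E.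
  by rewrite lee_fin prodr_ge0.
have slice z : \int[lebCn R n]_w (\prod_(j < n.+1) f (tnth [tuple of z :: w] j))%:E =
    (f z)%:E * (c ^+ n)%:E.
  rewrite -IH -ge0_integralZl ?lee_fin//; last exact: mprod.
  apply: eq_integral => w _; rewrite big_ord_recl tnth0 -EFinM.
  by under eq_bigr do rewrite tnthS.
rewrite ge0_integral_lebCnS//.
under eq_integral do rewrite slice.
have c0 : 0 <= c%:E by rewrite -fc integral_ge0// => z _; rewrite lee_fin.
rewrite ge0_integralZr ?fc -?EFinM ?exprS//.
- exact/measurable_EFinP.
- by move=> z _; rewrite lee_fin.
- by rewrite lee_fin exprn_ge0.
Qed.

End lebesgue_measure_Cn.

(** * Gaussian integrals *)

Section gaussian.
Context (R : realType).
Local Notation R2 := (R * R)%type.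
Implicit Types a b c r x y : R.

Lemma gauss_integral_R a : 0 < a ->
  (\int[@lebesgue_measure R]_x (expR (- (a * x ^+ 2)))%:E = (Num.sqrt (pi / a))%:E)%E.
Proof.
move=> a0; pose s := Num.sqrt (2 * a)^-1.
have s0 : 0 < s by rewrite sqrtr_gt0 invr_gt0 mulr_gt0.
have s2 : s ^+ 2 *+ 2 = a^-1.
  rewrite sqr_sqrtr ?invr_ge0 ?mulr_ge0// ?(ltW a0)//.
  by rewrite -mulr_natr; field; rewrite gt_eqF.
have peak_inv : (normal_peak s)^-1 = Num.sqrt (pi / a).
  by rewrite /normal_peak invrK -mulrnAl s2 mulrC.
have peak0 := normal_peak_gt0 (lt0r_neq0 s0).
rewrite -peak_inv -[RHS]mule1 -(integral_normal_pdf 0 s) -ge0_integralZl//.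
- apply: eq_integral => x _; rewrite normal_pdfE ?gt_eqF// -EFinM mulKf ?gt_eqF//.
  by rewrite /normal_fun subr0 s2 invrK mulNr mulrC.
- by apply/measurable_EFinP; exact: measurable_normal_pdf.
- by move=> x _; rewrite lee_fin normal_pdf_ge0.
- by rewrite lee_fin invr_ge0 ltW.
Qed.

Lemma measurable_gauss_R a : measurable_fun setT (fun x : R => expR (- (a * x ^+ 2))).
Proof.
apply: measurableT_comp => //; apply: measurableT_comp => //.
by apply: measurable_funM => //; exact: measurable_funX.
Qed.

Definition gauss_C a c (z : R2) : R :=
  expR (- (a * z.1 ^+ 2)) * expR (- (c * z.2 ^+ 2)).

Lemma measurable_gauss_C a c : measurable_fun setT (gauss_C a c).
Proof.
by apply: measurable_funM; apply: measurableT_comp (measurable_gauss_R _) _.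
Qed.

Lemma gauss_integral_C a c : 0 < a -> 0 < c ->
  (\int[lebC R]_z (gauss_C a c z)%:E = (pi / Num.sqrt (a * c))%:E)%E.
Proof.
move=> a0 c0.
have mg b :
    measurable_fun [set: measurableTypeR R] (fun x : R => (expR (- (b * x ^+ 2)))%:E).
  by apply/measurable_EFinP; exact: measurable_gauss_R.
rewrite ge0_integral_lebC; first last.
- by move=> z; rewrite lee_fin mulr_ge0 ?expR_ge0.
- by apply/measurable_EFinP; exact: measurable_gauss_C.
under eq_integral => x _.
  under eq_integral do rewrite /gauss_C /= EFinM.
  rewrite ge0_integralZl//= gauss_integral_R//; over.
rewrite ge0_integralZr//= gauss_integral_R// -EFinM; congr EFin.
rewrite -sqrtrM ?divr_ge0 ?pi_ge0 ?ltW// mulf_div sqrtrM ?mulr_ge0 ?pi_ge0//.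
by rewrite sqrtrV ?mulr_ge0 ?(ltW a0) ?(ltW c0)// -expr2 sqrtr_sqr ger0_norm ?pi_ge0.
Qed.

Section Cn.
Variable n : nat.
Implicit Type t : n.-tuple R2.

Definition qform a c t : R :=
  \sum_(j < n) (a * (tnth t j).1 ^+ 2 + c * (tnth t j).2 ^+ 2).

Definition gauss_Cn a c t : R := expR (- qform a c t).

Lemma gauss_Cn_prod a c t : gauss_Cn a c t = \prod_(j < n) gauss_C a c (tnth t j).
Proof.
rewrite /gauss_Cn /qform -sumrN expR_sum; apply: eq_bigr => j _.
by rewrite opprD expRD.
Qed.

Lemma gauss_CnM a c a' c' t :
  gauss_Cn a c t * gauss_Cn a' c' t = gauss_Cn (a + a') (c + c') t.
Proof.
rewrite -expRD -opprD -big_split; congr (expR (- _)).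
by apply: eq_bigr => j _ /=; ring.
Qed.

Lemma gauss_Cn_powR a c r t : gauss_Cn a c t `^ r = gauss_Cn (a * r) (c * r) t.
Proof.
rewrite -expRM mulNr mulr_suml; congr (expR (- _)).
by apply: eq_bigr => j _ /=; ring.
Qed.

Lemma expR_qform a c t : expR (qform a c t) = gauss_Cn (- a) (- c) t.
Proof.
by rewrite /gauss_Cn -sumrN; congr expR; apply: eq_bigr => j _; ring.
Qed.

Lemma gauss_Cn_ge0 a c t : 0 <= gauss_Cn a c t.
Proof. exact: expR_ge0. Qed.

Lemma measurable_gauss_Cn a c : measurable_fun setT (gauss_Cn a c).
Proof.
rewrite (funext (gauss_Cn_prod a c)).
apply: measurable_prod => j _.
exact: measurableT_comp (measurable_gauss_C a c) (measurable_tnth j).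
Qed.

Lemma gauss_integral_Cn a c : 0 < a -> 0 < c ->
  (\int[lebCn R n]_t (gauss_Cn a c t)%:E = ((pi / Num.sqrt (a * c)) ^+ n)%:E)%E.
Proof.
move=> a0 c0; under eq_integral do rewrite gauss_Cn_prod.
apply: ge0_integral_lebCn_prod (measurable_gauss_C a c) _ (gauss_integral_C a0 c0).
by move=> z; rewrite mulr_ge0 ?expR_ge0.
Qed.

Lemma gauss_prefactorM b x y : 0 < b -> 0 < x -> 0 < y ->
  (b / pi) ^+ n * (pi / Num.sqrt (b * x * (b * y))) ^+ n = Num.sqrt (x * y) ^- n.
Proof.
move=> b0 x0 y0; rewrite -exprMn -exprVn; congr (_ ^+ n).
rewrite [LHS]mulrA divfK ?gt_eqF ?pi_gt0//.
rewrite mulrACA -expr2 sqrtrM ?sqr_ge0// sqrtr_sqr gtr0_norm//.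
by rewrite invfM mulrA mulfV ?gt_eqF// mul1r.
Qed.

Lemma integrable_gauss_Cn a c : 0 < a -> 0 < c ->
  (lebCn R n).-integrable setT (EFin \o gauss_Cn a c).
Proof.
move=> a0 c0; apply/integrableP; split.
  by apply/measurable_EFinP; exact: measurable_gauss_Cn.
under eq_integral do rewrite /= ger0_norm ?gauss_Cn_ge0//.
by rewrite gauss_integral_Cn// ltry.
Qed.

End Cn.
End gaussian.

Section gauss_measure_Cn.
Context (R : realType) (n : nat).
Local Notation R2 := (R * R)%type.
Implicit Types (a : R) (t : n.-tuple R2).

Definition gauss_density a t : R := (a / pi) ^+ n * expR (- a * sqnorm R n t).

Lemma gauss_densityE a t : gauss_density a t = (a / pi) ^+ n * gauss_Cn a a t.
Proof.
rewrite /gauss_density mulNr mulr_sumr; congr (_ * expR (- _)).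
by apply: eq_bigr => j _; rewrite mulrDr.
Qed.

Lemma measurable_gauss_density a : measurable_fun setT (gauss_density a).
Proof.
rewrite (funext (gauss_densityE a)).
by apply: measurable_funM => //; exact: measurable_gauss_Cn.
Qed.

Lemma gauss_density_ge0 a t : 0 <= a -> 0 <= gauss_density a t.
Proof. by move=> a0; rewrite mulr_ge0 ?expR_ge0// exprn_ge0// divr_ge0// pi_ge0. Qed.

Definition gaussCn_measure a (a0 : 0 <= a) : {measure set (n.-tuple R2) -> \bar R} :=
  density_measure (lebCn R n) (fun t => gauss_density_ge0 t a0)
    (measurable_gauss_density a).

Lemma gaussCn_measureE a (a0 : 0 <= a) :
  gaussCn_measure a0 = gaussCn R n a :> (set _ -> _).
Proof. by []. Qed.

Lemma integral_gaussCn a (f : n.-tuple R2 -> R) : 0 <= a -> measurable_fun setT f ->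
  (\int[gaussCn R n a]_t (f t)%:E =
   \int[lebCn R n]_t (f t * ((a / pi) ^+ n * gauss_Cn a a t))%:E)%E.
Proof.
move=> a0 mf; transitivity (\int[lebCn R n]_t (f t * gauss_density a t)%:E)%E.
  exact: (integral_density (lebCn R n) (fun t => gauss_density_ge0 t a0)
    (measurable_gauss_density a)).
by apply: eq_integral => t _; rewrite gauss_densityE.
Qed.

End gauss_measure_Cn.

Section complex_integral.
Context d (T : measurableType d) (R : realType) (mu : {measure set T -> \bar R}).

Lemma ler_dot_normc (a b : R) (z : R[i]) :
  a * complex.Re z + b * complex.Im z <= normc (Complex a b) * normc z.
Proof.
have -> : a * complex.Re z + b * complex.Im z = complex.Re (conjc (Complex a b) * z).
  by case: z => x y /=; ring.
rewrite -(normc_conjc (Complex a b)) -ComplexField.Normc.normcM.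
exact: le_trans (ler_norm _) (ler_normc_Re _).
Qed.

(* Pairing the integral with itself reduces the inequality to the real
   integrand [a * Re X + b * Im X <= normc (a + i b) * normc X]. *)
Lemma ler_normc_integral (X : T -> R[i]) :
  measurable_fun setT (fun t => complex.Re (X t)) ->
  measurable_fun setT (fun t => complex.Im (X t)) ->
  mu.-integrable setT (fun t => (normc (X t))%:E) ->
  normc (Complex (\int[mu]_t complex.Re (X t)) (\int[mu]_t complex.Im (X t)))
  <= \int[mu]_t normc (X t).
Proof.
move=> mR mI iN.
have i_le (f : T -> R) : measurable_fun setT f -> (forall t, `|f t| <= normc (X t)) ->
    mu.-integrable setT (EFin \o f).
  move=> mf fX; apply: le_integrable iN => //; first exact/measurable_EFinP.
  by move=> t _; rewrite lee_fin (ger0_norm (normc_ge0 _)).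
have iR := i_le _ mR (fun t => ler_normc_Re (X t)).
have iI := i_le _ mI (fun t => ler_normc_Im (X t)).
set a := Rintegral _ _ _; set b := Rintegral _ _ (fun t => complex.Im _).
have [->|N0] := eqVneq (normc (Complex a b)) 0.
  by apply: Rintegral_ge0 => t _; exact: normc_ge0.
have Ngt0 : 0 < normc (Complex a b) by rewrite lt_neqAle eq_sym N0 normc_ge0.
have iZ (c : R) (f : T -> R) : mu.-integrable setT (EFin \o f) ->
    mu.-integrable setT (EFin \o (fun t => c * f t)).
  by move=> fi; exact: (integrableZl measurableT c fi).
rewrite -(ler_pM2l Ngt0) -expr2 [X in X ^+ 2]/= sqr_sqrtr ?addr_ge0 ?sqr_ge0//.
rewrite !expr2 -RintegralZl// -RintegralZl// -RintegralZl//.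
rewrite -RintegralD//; [|exact: iZ..].
apply: le_Rintegral => //.
- exact: (integrableD measurableT (iZ a _ iR) (iZ b _ iI)).
- exact: iZ.
- by move=> t _; exact: ler_dot_normc.
Qed.

End complex_integral.

(** * Measurability of continuous functions on C^n *)

Lemma measurable_countable_comp d d' (T : measurableType d) (T' : measurableType d')
    (I : countType) (q : T -> I) (g : I -> T') :
  (forall i, measurable (q @^-1` [set i])) -> measurable_fun setT (g \o q).
Proof.
move=> mq _ A _; rewrite setTI comp_preimage.
have -> : q @^-1` (g @^-1` A) = \bigcup_(i in g @^-1` A) q @^-1` [set i].
  by apply/seteqP; split => [t gt|t [i gi /= qti]]; [exists (q t)|rewrite /= qti].
rewrite bigcup_mkcond; apply: countable_bigcupT_measurable => [|i].
  exact: countableP.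
by case: ifPn.
Qed.

Lemma measurable_floor_fiber (R : realType) (m : int) :
  measurable [set x : R | Num.floor x = m].
Proof.
rewrite (_ : mkset _ = `[m%:~R, (m + 1)%:~R[%classic) ?measurable_itv//.
apply/seteqP; split => x /=; rewrite in_itv /=; last exact: floor_def.
by move=> <-; exact: floor_itv.
Qed.

Lemma dist_floor_grid_le (R : archiRealFieldType) (x : R) (k : nat) :
  `|x - (Num.floor (k.+1%:R * x))%:~R / k.+1%:R| <= k.+1%:R^-1.
Proof.
have k0 : 0 < k.+1%:R :> R by rewrite ltr0n.
have /andP[fl fu] := floor_itv (k.+1%:R * x).
rewrite -{1}(mulKf (lt0r_neq0 k0) x) mulrC -mulrBl normrM.
rewrite [X in _ * X]gtr0_norm ?invr_gt0//.
rewrite rmorphD addrC -ltrBlDr in fu.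
by rewrite ler_piMl ?invr_ge0 ?(ltW k0)// ger0_norm ?subr_ge0// ltW.
Qed.

Lemma cvg_row (K : numFieldType) (n : nat) (T : Type) (F : set_system T)
    {FF : Filter F} (u : T -> 'rV[K]_n) (x : 'rV[K]_n) :
  (forall e : K, 0 < e -> \forall t \near F, forall j, `|x 0 j - u t 0 j| < e) ->
  u t @[t --> F] --> x.
Proof.
move=> ux; apply/cvg_ballP => e e0; apply: filterS (ux e e0) => t xut.
by split=> // i j; rewrite (ord1 i); exact: xut.
Qed.

Section continuity_complex.
Context (R : realType).
Local Notation C := (R[i] : numFieldType).

Lemma normc_contraction_continuous (F : C -> R) :
  (forall z w, `|F z - F w| <= normc (z - w)) -> continuous F.
Proof.
move=> FC z; apply/(cvgrPdist_lt (FF := nbhs_filter z)) => e e0.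
have eC0 : 0 < (e%:C)%C :> C by rewrite ltcR.
apply/nbhs_ballP; exists (e%:C)%C => // w.
by rewrite -ball_normE /= normr_complexE ltcR; exact: le_lt_trans.
Qed.

Lemma continuous_Re : continuous (@complex.Re R : C -> R).
Proof. by apply: normc_contraction_continuous => z w; rewrite -raddfB ler_normc_Re. Qed.

Lemma continuous_Im : continuous (@complex.Im R : C -> R).
Proof. by apply: normc_contraction_continuous => z w; rewrite -raddfB ler_normc_Im. Qed.

Lemma continuous_normc : continuous (normc : C -> R).
Proof. by apply: normc_contraction_continuous => z w; exact: ler_dist_normc. Qed.

Lemma continuous_conjc : continuous (@conjc R : C -> C).
Proof.
move=> z; apply/(cvgrPdist_lt (FF := nbhs_filter z)) => e e0.
apply/nbhs_ballP; exists e => // w.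
by rewrite -ball_normE /= -rmorphB normcJ.
Qed.

Lemma continuous_mul_conjc (T : topologicalType) (g h : T -> C) :
  continuous g -> continuous h -> continuous (fun z => g z * conjc (h z) : C).
Proof.
move=> cg ch z.
exact: (continuousM (cg z) (continuous_comp (ch z) (@continuous_conjc (h z)))).
Qed.

Lemma holomorphic_continuous (n : nat) (f : 'rV[C]_n -> C) :
  holomorphic R n f -> continuous f.
Proof. by move=> hf z; exact: differentiable_continuous (hf z). Qed.

End continuity_complex.

Section continuous_measurable_Cn.
Context (R : realType) (n : nat).
Local Notation C := (R[i] : numFieldType).
Implicit Types (k : nat) (t : n.-tuple (R * R)).

Definition grid_index k t : n.-tuple (int * int) :=
  [tuple (Num.floor (k.+1%:R * (tnth t j).1),
          Num.floor (k.+1%:R * (tnth t j).2)) | j < n].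

Definition grid_point k (i : n.-tuple (int * int)) : n.-tuple (R * R) :=
  [tuple ((tnth i j).1%:~R / k.+1%:R, (tnth i j).2%:~R / k.+1%:R) | j < n].

Lemma measurable_grid_index_fiber k i : measurable (grid_index k @^-1` [set i]).
Proof.
have mfl (f : n.-tuple (R * R) -> R) (m : int) : measurable_fun setT f ->
    measurable [set t | Num.floor (k.+1%:R * f t) = m].
  move=> mf; rewrite -[X in measurable X]setTI.
  have mkf : measurable_fun setT (fun t => k.+1%:R * f t) by exact: measurable_funM.
  exact: (mkf measurableT _ (measurable_floor_fiber m)).
rewrite (_ : _ @^-1` _ = \bigcap_(j in [set: 'I_n])
    ([set t | Num.floor (k.+1%:R * (tnth t j).1) = (tnth i j).1] `&`
     [set t | Num.floor (k.+1%:R * (tnth t j).2) = (tnth i j).2])).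
  apply: fin_bigcap_measurable => // j _; apply: measurableI; apply: mfl.
    exact: measurableT_comp measurable_fst (measurable_tnth j).
  exact: measurableT_comp measurable_snd (measurable_tnth j).
apply/seteqP; split => [t <- j _|t ti]; first by rewrite /= !tnth_mktuple.
apply/eq_from_tnth => j; have [/= t1 t2] := ti j Logic.I.
by rewrite tnth_mktuple t1 t2 -surjective_pairing.
Qed.

Lemma grid_point_cvg t :
  rowC R n (grid_point k (grid_index k t)) @[k --> \oo] --> (rowC R n t : 'rV[C]_n).
Proof.
apply: cvg_row => _ /gt0_complexP[e e0 ->].
have e2 : 0 < e / 2 by rewrite divr_gt0.
near=> k => j.
rewrite !mxE !tnth_mktuple /= normr_complexE ltcR.
apply: le_lt_trans (ler_normc_Complex _ _) _.
apply: le_lt_trans (lerD (dist_floor_grid_le _ k) (dist_floor_grid_le _ k)) _.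
rewrite (splitr e) ltrD//; near: k; exact: (near_infty_natSinv_lt (PosNum e2)).
Unshelve. all: by end_near. Qed.

(* [F \o rowC] is the pointwise limit of its compositions with rounding to finer and
   finer grids, and these have countable range. *)
Lemma continuous_measurable_rowC (F : 'rV[C]_n -> R) :
  continuous F -> measurable_fun setT (fun t => F (rowC R n t)).
Proof.
move=> cF; apply: (measurable_fun_cvg
  (h := fun k => (F \o rowC R n \o grid_point k) \o grid_index k)) => [k|t _].
  by apply: measurable_countable_comp => i; exact: measurable_grid_index_fiber.
exact: (cvg_comp _ _ (@grid_point_cvg t) (cF _)).
Qed.

Lemma continuous_measurable_comp_rowC (F : C -> R) (f : 'rV[C]_n -> C) :
  continuous F -> continuous f -> measurable_fun setT (fun t => F (f (rowC R n t))).
Proof.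
move=> cF cf; apply: (continuous_measurable_rowC (F := F \o f)) => z.
exact: (continuous_comp (cf z) (cF (f z))).
Qed.

End continuous_measurable_Cn.

(** * The upper bound *)

Section powR_complements.
Context (R : realType).
Implicit Types (x r : R).

Lemma powRV x r : 0 <= x -> x^-1 `^ r = (x `^ r)^-1.
Proof. by move=> x0; rewrite -powR_inv1// -powRrM mulN1r powRN. Qed.

Lemma powR_exprn x r n : 0 <= x -> (x ^+ n) `^ r = (x `^ r) ^+ n.
Proof. by move=> x0; rewrite -(powR_mulrn n x0) powRAC powR_mulrn ?powR_ge0. Qed.

End powR_complements.

Section conjugate_exponents.
Context (R : realType) (p p' : R).
Hypotheses (p0 : 0 < p) (p'0 : 0 < p') (pp' : p^-1 + p'^-1 = 1).

Lemma powR_conjugate (x : R) : 0 < x -> x `^ p^-1 * x `^ p'^-1 = x.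
Proof. by move=> x0; rewrite -powRD ?pp' ?powRr1 ?ltW// gt_eqF ?implybT. Qed.

Lemma CpE : Cp R p p' = (2 / p) `^ p^-1 * (2 / p') `^ p'^-1.
Proof.
rewrite /Cp -[X in X * _ * _](@powR_conjugate 2)// !powRM ?invr_ge0 ?ltW//.
by rewrite !powRN !powRV ?ltW//; ring.
Qed.

Lemma CpE_scale (x : R) : 0 < x ->
  Cp R p p' = x * ((2 / p) `^ p^-1 / x `^ p^-1 * ((2 / p') `^ p'^-1 / x `^ p'^-1)).
Proof.
move=> x0; rewrite [X in _ * X]mulrACA -invfM powR_conjugate// CpE.
by rewrite [RHS]mulrC divfK ?gt_eqF.
Qed.

Lemma Cp_gt0 : 0 < Cp R p p'.
Proof. by rewrite CpE mulr_gt0// powR_gt0// divr_gt0. Qed.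

End conjugate_exponents.

Section gaussian_hoelder.
Context (R : realType) (n : nat) (alpha : R).
Hypothesis alpha0 : 0 < alpha.
Local Notation R2 := (R * R)%type.
Local Notation half := (alpha / 2).

Definition gauss_norm (q : R) (F : n.-tuple R2 -> R) : R :=
  fine (\int[gaussCn R n (alpha * q / 2)]_t (F t `^ q)%:E) `^ q^-1.

Lemma integral_powR_mul_gauss (q : R) (F : n.-tuple R2 -> R) :
  0 < q -> measurable_fun setT F -> (forall t, 0 <= F t) ->
  (\int[lebCn R n]_t ((F t * gauss_Cn half half t) `^ q)%:E =
   ((2 / q / (alpha / pi)) ^+ n)%:E *
   \int[gaussCn R n (alpha * q / 2)]_t (F t `^ q)%:E)%E.
Proof.
move=> q0 mF F0; have pi0 := pi_gt0 R.
have mFq : measurable_fun setT (fun t => F t `^ q).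
  exact: (measurableT_comp (measurable_powR q) mF).
have aq0 : 0 <= alpha * q / 2 by rewrite divr_ge0 ?mulr_ge0 ?ltW.
have prefactorV (x : R) : 0 < x -> 2 / q / (alpha / x) * (alpha * q / 2 / x) = 1.
  by move=> x0; field; rewrite !gt_eqF.
rewrite integral_gaussCn// -ge0_integralZl//.
- apply: eq_integral => t _.
  rewrite powRM ?gauss_Cn_ge0// gauss_Cn_powR -EFinM; congr EFin.
  by rewrite [RHS]mulrCA [X in _ = _ * X]mulrA -exprMn prefactorV// expr1n mul1r mulrAC.
- apply/measurable_EFinP/measurable_funM => //; apply: measurable_funM => //.
  exact: measurable_gauss_Cn.
- move=> t _; rewrite lee_fin mulr_ge0 ?powR_ge0// mulr_ge0 ?gauss_Cn_ge0//.
  by rewrite exprn_ge0// divr_ge0// ltW.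
- by rewrite lee_fin exprn_ge0// !divr_ge0 ?ltW.
Qed.

Lemma Lnorm_mul_gauss (q : R) (F : n.-tuple R2 -> R) :
  0 < q -> measurable_fun setT F -> (forall t, 0 <= F t) ->
  (\int[gaussCn R n (alpha * q / 2)]_t (F t `^ q)%:E < +oo)%E ->
  Lnorm (lebCn R n) q%:E (EFin \o (fun t => F t * gauss_Cn half half t)) =
  (((2 / q) `^ q^-1 / (alpha / pi) `^ q^-1) ^+ n * gauss_norm q F)%:E.
Proof.
move=> q0 mF F0; set I := (X in (X < +oo)%E) => Foo.
have c0 : 0 < alpha / pi by rewrite divr_gt0 ?pi_gt0.
have k0 : 0 <= 2 / q / (alpha / pi) by rewrite !divr_ge0 ?pi_ge0 ?ltW.
have aq0 : 0 <= alpha * q / 2 by rewrite divr_ge0 ?mulr_ge0 ?ltW.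
have I0 : (0 <= I)%E.
  rewrite /I -(gaussCn_measureE n aq0).
  by apply: integral_ge0 => t _; rewrite lee_fin powR_ge0.
have absE t : `|F t * gauss_Cn half half t| = F t * gauss_Cn half half t.
  by rewrite ger0_norm// mulr_ge0 ?gauss_Cn_ge0.
rewrite unlock /=; under eq_integral do rewrite absE.
rewrite integral_powR_mul_gauss// -/I -[I]fineK ?ge0_fin_numE// -EFinM poweR_EFin.
rewrite (powRM _ (exprn_ge0 n k0) (fine_ge0 I0)) powR_exprn//.
by rewrite (@powRM _ (2 / q)) ?powRV ?invr_ge0 ?(ltW c0) ?divr_ge0 ?(ltW q0).
Qed.

Lemma gaussian_hoelder (p p' : R) (F G : n.-tuple R2 -> R) :
  0 < p -> 0 < p' -> p^-1 + p'^-1 = 1 ->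
  measurable_fun setT F -> (forall t, 0 <= F t) ->
  measurable_fun setT G -> (forall t, 0 <= G t) ->
  (\int[gaussCn R n (alpha * p / 2)]_t (F t `^ p)%:E < +oo)%E ->
  (\int[gaussCn R n (alpha * p' / 2)]_t (G t `^ p')%:E < +oo)%E ->
  (\int[gaussCn R n alpha]_t (F t * G t)%:E <=
   (Cp R p p' ^+ n * (gauss_norm p F * gauss_norm p' G))%:E)%E.
Proof.
move=> p0 p'0 pp' mF F0 mG G0 Foo Goo.
pose W := gauss_Cn (n := n) half half.
have W0 t : 0 <= W t by exact: gauss_Cn_ge0.
have mFW : measurable_fun setT (fun t => F t * W t).
  by apply: measurable_funM => //; exact: measurable_gauss_Cn.
have mGW : measurable_fun setT (fun t => G t * W t).
  by apply: measurable_funM => //; exact: measurable_gauss_Cn.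
have c0 : 0 < alpha / pi by rewrite divr_gt0 ?pi_gt0.
have k0 : 0 <= (alpha / pi) ^+ n by rewrite exprn_ge0// ltW.
have -> : (\int[gaussCn R n alpha]_t (F t * G t)%:E = ((alpha / pi) ^+ n)%:E *
    \int[lebCn R n]_t `|((F t * W t) * (G t * W t))%:E|)%E.
  rewrite integral_gaussCn ?(ltW alpha0)//; last exact: measurable_funM.
  rewrite -ge0_integralZl//; last first.
    by do 2 apply: measurableT_comp => //; exact: measurable_funM.
  apply: eq_integral => t _; rewrite gee0_abs ?lee_fin ?mulr_ge0// -EFinM; congr EFin.
  by rewrite [in RHS]mulrACA gauss_CnM -splitr mulrCA.
have := hoelder (lebCn R n) mFW mGW p0 p'0 pp'.
rewrite !Lnorm_mul_gauss// -EFinM Lnorm1 => FG.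
apply: le_trans (lee_wpmul2l _ FG) _; first by rewrite lee_fin.
rewrite -EFinM lee_fin (CpE_scale p0 p'0 pp' c0) [X in _ <= X * _]exprMn.
by rewrite [X in _ <= _ * X * _]exprMn -[leRHS]mulrA [X in _ <= _ * X]mulrACA.
Qed.

End gaussian_hoelder.

Section upper_bound.
Context (R : realType) (n : nat) (alpha p p' : R).
Hypotheses (alpha0 : 0 < alpha) (p0 : 0 < p) (p'0 : 0 < p') (pp' : p^-1 + p'^-1 = 1).
Local Notation C := (R[i] : numFieldType).
Implicit Types g h : 'rV[C]_n -> C.

Lemma ler_normc_inner g h : Hspace R n p alpha g -> Hspace R n p' alpha h ->
  normc (inner R n alpha g h) <=
    Cp R p p' ^+ n * (pnorm R n p alpha g * pnorm R n p' alpha h).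
Proof.
move=> [/holomorphic_continuous cg gp] [/holomorphic_continuous ch hp].
have mN f cf := @continuous_measurable_comp_rowC R n normc f (@continuous_normc R) cf.
have cgh := continuous_mul_conjc cg ch.
have hoelder_gh := gaussian_hoelder alpha0 p0 p'0 pp' (mN g cg) (fun=> normc_ge0 _)
  (mN h ch) (fun=> normc_ge0 _) gp hp.
set B := Cp R p p' ^+ n * _ in hoelder_gh.
pose X t := g (rowC R n t) * conjc (h (rowC R n t)).
pose nu := gaussCn_measure n (ltW alpha0).
have NX : (\int[nu]_t (normc (X t))%:E <= B%:E)%E.
  under eq_integral do rewrite ComplexField.Normc.normcM normc_conjc.
  exact: hoelder_gh.
have iN : nu.-integrable setT (fun t => (normc (X t))%:E).
  apply/integrableP; split; first by apply/measurable_EFinP; exact: mN cgh.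
  under eq_integral do rewrite gee0_abs ?lee_fin ?normc_ge0//.
  exact: le_lt_trans NX (ltry _).
have mRe := continuous_measurable_comp_rowC (@continuous_Re R) cgh.
have mIm := continuous_measurable_comp_rowC (@continuous_Im R) cgh.
apply: le_trans (ler_normc_integral mRe mIm iN) _.
rewrite -lee_fin fineK// ge0_fin_numE ?(le_lt_trans NX) ?ltry//.
by apply: integral_ge0 => t _; rewrite lee_fin normc_ge0.
Qed.

Lemma ratio_le_Cp g h : Hspace R n p alpha g -> Hspace R n p' alpha h ->
  Defs.ratio R n p p' alpha g h <= Cp R p p' ^+ n.
Proof.
move=> Hg Hh; have := ler_normc_inner Hg Hh; rewrite /Defs.ratio.
have : 0 <= pnorm R n p alpha g * pnorm R n p' alpha h by rewrite mulr_ge0 ?powR_ge0.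
rewrite le_eqVlt => /orP[/eqP<- _|norms0 inner_le]; last by rewrite ler_pdivrMr.
by rewrite invr0 mulr0 exprn_ge0// ltW// Cp_gt0.
Qed.

End upper_bound.

(** * The complex exponential *)

Lemma is_diff_linear_approx (K : numFieldType) (V W : normedModType K)
    (f df : V -> W) (z : V) : is_diff z f df ->
  forall e : K, 0 < e -> exists2 d : K, 0 < d &
    forall h, `|h| < d -> `|f (h + z) - f z - df h| <= e * `|h|.
Proof.
move=> fz e e0; have /eqaddoP := diff_locally (@ex_diff _ _ _ _ _ _ _ fz).
rewrite diff_val => /(_ e e0) /nbhs_normP[d d0 fd]; exists d => // h hd.
by rewrite -addrA -opprD; apply: fd; rewrite /ball_ /= sub0r normrN.
Qed.

Lemma linear_approx_differentiable (K : numFieldType) (f : K^o -> K^o) (z l : K) :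
  (forall e : K, 0 < e -> exists2 d : K, 0 < d &
    forall h, `|h| < d -> `|f (h + z) - f z - l * h| <= e * `|h|) ->
  differentiable f z.
Proof.
move=> fl; have cl := @scaler_continuous _ K^o l.
suff fo : f \o shift z = cst (f z) + *:%R l +o_ (0 : K^o) id.
  by apply/diff_locallyP; rewrite (diff_unique cl fo).
apply/eqaddoP => e /fl[d d0 fd]; apply/nbhs_normP; exists d => // h.
by rewrite /ball_ /= sub0r normrN => /fd; rewrite opprD addrA.
Qed.

Section cauchy_riemann.
Context (R : realType).
Local Notation C := (R[i] : numFieldType).

Lemma cauchy_riemann_differentiable (u v : R * R -> R) (p q : R) (z : R * R) :
  is_diff z u (fun h => p * h.1 - q * h.2) ->
  is_diff z v (fun h => p * h.2 + q * h.1) ->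
  differentiable (fun w : C^o => Complex (u (complex.Re w, complex.Im w))
    (v (complex.Re w, complex.Im w)) : C^o) (toC R z : C^o).
Proof.
case: z => x y du dv.
apply: (@linear_approx_differentiable _ _ _ (Complex p q)) => _ /gt0_complexP[e e0 ->].
have e2 : 0 < e / 2 by rewrite divr_gt0.
have [r r0 ur] := is_diff_linear_approx du e2.
have [s s0 vs] := is_diff_linear_approx dv e2.
exists ((Num.min r s)%:C)%C => [|[a b]]; first by rewrite ltcR lt_min r0 s0.
rewrite normr_complexE ltcR lt_min => /andP[abr abs].
have abN : `|(a, b)| <= normc (Complex a b).
  rewrite prod_normE/= ge_max.
  by rewrite (ler_normc_Re (Complex a b)) (ler_normc_Im (Complex a b)).
have := vs _ (le_lt_trans abN abs).
have := ur _ (le_lt_trans abN abr).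
move=> /le_trans/(_ (ler_wpM2l (ltW e2) abN)) uab.
move=> /le_trans/(_ (ler_wpM2l (ltW e2) abN)) vab.
rewrite !normr_complexE -rmorphM lecR.
rewrite [X in _ <= X * _](splitr e) mulrDl (le_trans _ (lerD uab vab))//.
exact: ler_normc_Complex.
Qed.

End cauchy_riemann.

Lemma is_diff_fst (K : numFieldType) (V W : normedModType K) (z : V * W) :
  is_diff z (fst : V * W -> V) fst.
Proof.
have fst_cont : continuous (fst : V * W -> V) by move=> ?; exact: cvg_fst.
by apply: DiffDef; [exact: linear_differentiable|exact: diff_lin].
Qed.

Lemma is_diff_snd (K : numFieldType) (V W : normedModType K) (z : V * W) :
  is_diff z (snd : V * W -> W) snd.
Proof.
have snd_cont : continuous (snd : V * W -> W) by move=> ?; exact: cvg_snd.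
by apply: DiffDef; [exact: linear_differentiable|exact: diff_lin].
Qed.

Lemma is_derive_is_diff (K : numFieldType) (f : K -> K) (x l : K) :
  is_derive x 1 f l -> is_diff x f ( *%R l).
Proof.
move=> [df dfE]; apply: DiffDef; first exact/derivable1_diffP.
by rewrite deriv1E// derive1E dfE; apply/funext => h; rewrite [LHS]mulrC.
Qed.

Lemma is_diff_mul_fst_snd (R : realType) (f g : R -> R) (x y f' g' : R) :
  is_derive x 1 f f' -> is_derive y 1 g g' ->
  is_diff (x, y) (fun h : R * R => f h.1 * g h.2)
    (fun h => f' * g y * h.1 + f x * g' * h.2).
Proof.
move=> /is_derive_is_diff df /is_derive_is_diff dg.
have dfg := is_diffM (is_diff_comp (is_diff_fst (x, y)) df)
  (is_diff_comp (is_diff_snd (x, y)) dg).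
apply: is_diff_eq dfg _.
apply/funext => h; rewrite !fctE /= /GRing.scale /=; ring.
Qed.

Section complex_exponential.
Context (R : realType).
Local Notation C := (R[i] : numFieldType).

Definition cexp (z : R[i]) : R[i] :=
  Complex (expR (complex.Re z) * cos (complex.Im z))
          (expR (complex.Re z) * sin (complex.Im z)).

Lemma normc_cexp z : normc (cexp z) = expR (complex.Re z).
Proof.
by rewrite /= !exprMn -mulrDr cos2Dsin2 mulr1 sqrtr_sqr ger0_norm// expR_ge0.
Qed.

Lemma cexp_mul_conjc z w : cexp z * conjc (cexp w) = cexp (z + conjc w).
Proof.
case: z w => a b [c d]; rewrite /cexp /= expRD cosD sinD cosN sinN; simpc.
by congr Complex; ring.
Qed.

Lemma differentiable_cexp (z : C^o) : differentiable (cexp : C^o -> C^o) z.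
Proof.
case: z => x y.
apply: (@cauchy_riemann_differentiable _ (fun h => expR h.1 * cos h.2)
  (fun h => expR h.1 * sin h.2) (expR x * cos y) (expR x * sin y) (x, y)).
  apply: is_diff_eq (is_diff_mul_fst_snd (is_derive_expR x) (is_derive_cos y)) _.
  by apply/funext => h; ring.
apply: is_diff_eq (is_diff_mul_fst_snd (is_derive_expR x) (is_derive_sin y)) _.
by apply/funext => h; ring.
Qed.

End complex_exponential.

(** * The lower bound *)

Section cosine_bound.
Context (R : realType).
Implicit Type x : R.

Lemma one_sub_cos_le x : 1 - cos x <= `|x|.
Proof.
wlog x0 : x / 0 < x.
  move=> H; have [/H//|x0|<-] := ltgtP 0 x; last by rewrite cos0 subrr.
  by rewrite -cosN -normrN H// oppr_gt0.
have dcos y : y \in `]0, x[%R -> is_derive y 1 (@cos R) (- sin y).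
  by move=> _; exact: is_derive_cos.
have ccos : {within `[0, x], continuous (@cos R)}.
  by apply: continuous_subspaceT => y; exact: continuous_cos.
have [c _] := MVT x0 dcos ccos; rewrite cos0 subr0 => cosx.
rewrite -opprB cosx mulNr opprK (le_trans (ler_norm _))// normrM ler_piMl//.
exact: sin_max.
Qed.

Lemma cos_ge_expR x : 2 - expR `|x| <= cos x.
Proof. have := one_sub_cos_le x; have := expR_ge1Dx `|x|; lra. Qed.

End cosine_bound.

Section oscillating_gaussian.
Context (R : realType) (n : nat).
Local Notation R2 := (R * R)%type.
Implicit Types (a c k : R) (t : n.-tuple R2).

Definition crossform t : R := \sum_(j < n) (tnth t j).1 * (tnth t j).2.

Lemma measurable_scale_crossform k : measurable_fun setT (fun t => k * crossform t).
Proof.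
apply: measurable_funM => //; apply: measurable_sum => j; apply: measurable_funM.
  exact: measurableT_comp measurable_fst (measurable_tnth j).
exact: measurableT_comp measurable_snd (measurable_tnth j).
Qed.

Lemma norm_crossform_le k a c t : 0 <= a -> 0 <= c -> k ^+ 2 <= 4 * a * c ->
  `|k * crossform t| <= qform a c t.
Proof.
move=> a0 c0 kac; rewrite mulr_sumr (le_trans (ler_norm_sum _ _ _))//.
apply: ler_sum => j _; case: (tnth t j) => x y /=.
have form_ge0 : 0 <= a * x ^+ 2 + c * y ^+ 2.
  by rewrite addr_ge0// mulr_ge0// sqr_ge0.
rewrite -ler_sqr ?nnegrE// real_normK ?num_real//.
apply: (@le_trans _ _ (4 * a * c * (x * y) ^+ 2)).
  by rewrite exprMn ler_wpM2r ?sqr_ge0.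
rewrite -subr_ge0 (_ : _ - _ = (a * x ^+ 2 - c * y ^+ 2) ^+ 2); last by ring.
exact: sqr_ge0.
Qed.

Lemma measurable_gauss_cos a c (u : n.-tuple R2 -> R) : measurable_fun setT u ->
  measurable_fun setT (fun t => gauss_Cn a c t * cos (u t)).
Proof.
move=> mu; apply: measurable_funM; first exact: measurable_gauss_Cn.
by apply: measurableT_comp mu; exact: continuous_measurable_fun (@continuous_cos R).
Qed.

Lemma integrable_gauss_cos a c (u : n.-tuple R2 -> R) :
  0 < a -> 0 < c -> measurable_fun setT u ->
  (lebCn R n).-integrable setT (EFin \o (fun t => gauss_Cn a c t * cos (u t))).
Proof.
move=> a0 c0 mu; have iG := integrable_gauss_Cn n a0 c0.
apply: le_integrable iG => //.
  by apply/measurable_EFinP; exact: measurable_gauss_cos.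
by move=> t _ /=; rewrite lee_fin normrM ler_piMr// cos_max.
Qed.

Lemma gauss_cos_integral_ge a c a' c' (u : n.-tuple R2 -> R) :
  0 < a -> 0 < c -> a' < a -> c' < c -> measurable_fun setT u ->
  (forall t, `|u t| <= qform a' c' t) ->
  2 * (pi / Num.sqrt (a * c)) ^+ n - (pi / Num.sqrt ((a - a') * (c - c'))) ^+ n <=
  \int[lebCn R n]_t (gauss_Cn a c t * cos (u t)).
Proof.
move=> a0 c0 a'a c'c mu u_le.
have a'a0 : 0 < a - a' by rewrite subr_gt0.
have c'c0 : 0 < c - c' by rewrite subr_gt0.
have iG := integrable_gauss_Cn n a0 c0; have iG' := integrable_gauss_Cn n a'a0 c'c0.
have i2G : (lebCn R n).-integrable setT (EFin \o (fun t => 2 * gauss_Cn a c t)).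
  exact: (integrableZl measurableT 2 iG).
have intG (x y : R) : 0 < x -> 0 < y ->
    (pi / Num.sqrt (x * y)) ^+ n = \int[lebCn R n]_t gauss_Cn x y t.
  by move=> x0 y0; rewrite /Rintegral gauss_integral_Cn.
rewrite !intG// -RintegralZl// -RintegralB//; apply: le_Rintegral => //.
- exact: (integrableB measurableT i2G iG').
- exact: integrable_gauss_cos.
- move=> t _; apply: le_trans (ler_wpM2l (gauss_Cn_ge0 a c t) (cos_ge_expR (u t))).
  rewrite mulrBr mulrC lerD2l lerN2 -gauss_CnM ler_wpM2l ?gauss_Cn_ge0//.
  by rewrite -expR_qform ler_expR.
Qed.

End oscillating_gaussian.

Lemma differentiable_sum_sqr (K : numFieldType) n (z : 'rV[K]_n) :
  differentiable (fun w : 'rV[K]_n => \sum_j w 0 j ^+ 2 : K^o) z.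
Proof.
rewrite (_ : (fun w => _) = \sum_(j < n) (fun w : 'rV[K]_n => w 0 j : K^o) ^+ 2).
  apply: differentiable_sum => j; apply: differentiableX.
  exact: differentiable_coord.
by apply/funext => w; rewrite fct_sumE.
Qed.

Section quadratic_exponentials.
Context (R : realType) (n : nat).
Local Notation R2 := (R * R)%type.
Local Notation C := (R[i] : numFieldType).
Implicit Types (b : R) (t : n.-tuple R2).

Definition cgauss b (z : 'rV[R[i]]_n) : R[i] := cexp ((b%:C)%C * \sum_j z 0 j ^+ 2).

Lemma holomorphic_cgauss b : holomorphic R n (cgauss b).
Proof.
move=> z; apply: (@differentiable_comp _ _ C^o C^o
    (fun w : 'rV[C]_n => (b%:C)%C * \sum_j w 0 j ^+ 2) (@cexp R)).
  exact: differentiableZ (differentiable_sum_sqr z).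
exact: differentiable_cexp.
Qed.

Lemma cgauss_neq0 b : cgauss b <> (fun=> 0).
Proof.
move=> /(congr1 (fun g => normc (g 0))); rewrite normc_cexp => /eqP.
by rewrite ComplexField.Normc.normc0 gt_eqF ?expR_gt0.
Qed.

Lemma cgauss_rowC b t :
  cgauss b (rowC R n t) = cexp (Complex (qform b (- b) t) (2 * b * crossform t)).
Proof.
rewrite /cgauss; congr cexp; rewrite mulr_sumr /qform /crossform mulr_sumr.
elim/big_rec3 : _ => // j x y z _ ->.
rewrite mxE /toC expr2; case: (tnth t j) => u v /=; simpc.
by congr Complex; ring.
Qed.

Lemma normc_cgauss_rowC b t : normc (cgauss b (rowC R n t)) = gauss_Cn (- b) b t.
Proof. by rewrite cgauss_rowC normc_cexp expR_qform opprK. Qed.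

Lemma Re_cgauss_conjc b b' t :
  complex.Re (cgauss b (rowC R n t) * conjc (cgauss b' (rowC R n t))) =
  gauss_Cn (- (b + b')) (b + b') t * cos (2 * (b - b') * crossform t).
Proof.
rewrite !cgauss_rowC cexp_mul_conjc.
rewrite -[in gauss_Cn _ (b + b')](opprK (b + b')) -expR_qform /=.
congr (expR _ * cos _); last by ring.
by rewrite -big_split /=; apply: eq_bigr => j _; ring.
Qed.

End quadratic_exponentials.

Section test_functions.
Context (R : realType) (n : nat) (alpha : R).
Hypothesis alpha0 : 0 < alpha.
Implicit Types s r q m a c : R.

Definition test_fun s : 'rV[R[i]]_n -> R[i] := cgauss (alpha * s / 2).

Lemma pint_test_fun q s : 0 < q -> -1 < s < 1 ->
  pint R n q alpha (test_fun s) = ((1 - s ^+ 2) `^ (- (n%:R / 2)))%:E.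
Proof.
move=> q0 /andP[sN1 s1]; pose b := alpha * q / 2.
have b0 : 0 < b by rewrite divr_gt0 ?mulr_gt0.
have sm0 : 0 < 1 - s by rewrite subr_gt0.
have sp0 : 0 < 1 + s by lra.
have normE t : normc (test_fun s (rowC R n t)) `^ q =
    gauss_Cn (- (alpha * s / 2) * q) (alpha * s / 2 * q) t.
  by rewrite normc_cgauss_rowC gauss_Cn_powR.
rewrite /pint -(gaussCn_measureE n (ltW b0)); under eq_integral do rewrite normE.
rewrite gaussCn_measureE integral_gaussCn ?(ltW b0)//; last exact: measurable_gauss_Cn.
have weightE t : gauss_Cn (- (alpha * s / 2) * q) (alpha * s / 2 * q) t *
    ((b / pi) ^+ n * gauss_Cn b b t) =
    (b / pi) ^+ n * gauss_Cn (b * (1 - s)) (b * (1 + s)) t.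
  have -> : b * (1 - s) = - (alpha * s / 2) * q + b by rewrite /b; field.
  have -> : b * (1 + s) = alpha * s / 2 * q + b by rewrite /b; field.
  by rewrite mulrCA gauss_CnM.
under eq_integral do rewrite weightE EFinM.
rewrite ge0_integralZl//; last 3 first.
- by apply/measurable_EFinP; exact: measurable_gauss_Cn.
- by move=> t _; rewrite lee_fin gauss_Cn_ge0.
- by rewrite lee_fin exprn_ge0// divr_ge0 ?pi_ge0// ltW.
rewrite gauss_integral_Cn ?mulr_gt0// -EFinM gauss_prefactorM//.
have -> : (1 - s) * (1 + s) = 1 - s ^+ 2 by ring.
have s2 : 0 <= 1 - s ^+ 2 by nra.
by rewrite -powR_invn ?sqrtr_ge0// -powR12_sqrt// -powRrM mulrN mulrC.
Qed.

Lemma pnorm_test_fun q s : 0 < q -> -1 < s < 1 ->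
  pnorm R n q alpha (test_fun s) = (((1 - s ^+ 2) `^ q^-1) `^ (n%:R / 2))^-1.
Proof.
by move=> q0 s1; rewrite /pnorm pint_test_fun//= powRAC powRN.
Qed.

Lemma test_fun_Hspace q s : 0 < q -> -1 < s < 1 -> Hspace R n q alpha (test_fun s).
Proof.
by move=> q0 s1; split; [exact: holomorphic_cgauss|rewrite pint_test_fun// ltry].
Qed.

Lemma Re_inner_test_fun s r m : s + r = 2 * m -> -1 < m < 1 ->
  complex.Re (inner R n alpha (test_fun s) (test_fun r)) = (alpha / pi) ^+ n *
  \int[lebCn R n]_t (gauss_Cn (alpha * (1 - m)) (alpha * (1 + m)) t *
                     cos (alpha * (s - r) * crossform t)).
Proof.
move=> srm /andP[mN1 m1]; pose u t := alpha * (s - r) * crossform (n := n) t.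
have mu : measurable_fun setT u by exact: measurable_scale_crossform.
pose nu := gaussCn_measure n (ltW alpha0).
have ReE t : complex.Re (test_fun s (rowC R n t) * conjc (test_fun r (rowC R n t))) =
    gauss_Cn (- (alpha * m)) (alpha * m) t * cos (u t).
  have -> : alpha * m = alpha * s / 2 + alpha * r / 2.
    by rewrite -mulrDl -mulrDr srm; field.
  have -> : u t = 2 * (alpha * s / 2 - alpha * r / 2) * crossform t.
    by rewrite /u; congr (_ * _); field.
  exact: Re_cgauss_conjc.
transitivity (\int[nu]_t (gauss_Cn (- (alpha * m)) (alpha * m) t * cos (u t))).
  exact: (eq_Rintegral nu (fun t _ => ReE t)).
rewrite /Rintegral /nu gaussCn_measureE integral_gaussCn ?(ltW alpha0)//; last first.
  exact: measurable_gauss_cos.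
have weightE t : gauss_Cn (- (alpha * m)) (alpha * m) t * cos (u t) *
    ((alpha / pi) ^+ n * gauss_Cn alpha alpha t) =
    (alpha / pi) ^+ n * (gauss_Cn (alpha * (1 - m)) (alpha * (1 + m)) t * cos (u t)).
  have -> : alpha * (1 - m) = - (alpha * m) + alpha by ring.
  have -> : alpha * (1 + m) = alpha * m + alpha by ring.
  by rewrite mulrCA mulrAC gauss_CnM.
under [in LHS]eq_integral do rewrite weightE.
rewrite -[LHS]/(\int[lebCn R n]_t ((alpha / pi) ^+ n * (_ * cos (u t)))) RintegralZl//.
by apply: integrable_gauss_cos; rewrite // mulr_gt0//; lra.
Qed.

Lemma ler_inner_test_fun s r m a c : s + r = 2 * m ->
  0 <= a < 1 - m -> 0 <= c < 1 + m -> (s - r) ^+ 2 <= 4 * a * c ->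
  2 * Num.sqrt ((1 - m) * (1 + m)) ^- n - Num.sqrt ((1 - m - a) * (1 + m - c)) ^- n <=
  normc (inner R n alpha (test_fun s) (test_fun r)).
Proof.
move=> srm /andP[a0 am] /andP[c0 cm] srac.
have m1 : 0 < 1 - m := le_lt_trans a0 am.
have mN1 : 0 < 1 + m := le_lt_trans c0 cm.
have am0 : 0 < 1 - m - a by rewrite subr_gt0.
have cm0 : 0 < 1 + m - c by rewrite subr_gt0.
apply: le_trans (ler_normc_Re _); apply: le_trans (ler_norm _).
rewrite (Re_inner_test_fun srm); last by apply/andP; split; lra.
have a'a : alpha * a < alpha * (1 - m) by rewrite ltr_pM2l.
have c'c : alpha * c < alpha * (1 + m) by rewrite ltr_pM2l.
have mu := @measurable_scale_crossform R n (alpha * (s - r)).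
have u_le (t : n.-tuple (R * R)) :
    `|alpha * (s - r) * crossform t| <= qform (alpha * a) (alpha * c) t.
  apply: norm_crossform_le; rewrite ?mulr_ge0 ?(ltW alpha0)//.
  rewrite exprMn (_ : 4 * _ * _ = alpha ^+ 2 * (4 * a * c)); last by ring.
  by rewrite ler_wpM2l ?sqr_ge0.
have prefactor_ge0 : 0 <= (alpha / pi) ^+ n.
  by rewrite exprn_ge0// divr_ge0 ?pi_ge0// ltW.
have := gauss_cos_integral_ge
  (mulr_gt0 alpha0 m1) (mulr_gt0 alpha0 mN1) a'a c'c mu u_le.
move=> /(ler_wpM2l prefactor_ge0).
by rewrite (mulrBr ((alpha / pi) ^+ n)) mulrCA -!(mulrBr alpha) !gauss_prefactorM.
Qed.

End test_functions.

Lemma ler_invXn (R : numFieldType) (n : nat) (x y : R) :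
  0 < x -> x <= y -> y ^- n <= x ^- n.
Proof.
move=> x0 xy; have y0 := lt_le_trans x0 xy.
by rewrite lef_pV2 ?posrE ?exprn_gt0// lerXn2r ?nnegrE ?(ltW x0) ?(ltW y0).
Qed.

Section near_optimal_ratio.
Context (R : realType) (n : nat) (alpha p p' : R).
Hypotheses (alpha0 : 0 < alpha) (p1 : 1 < p) (p'1 : 1 < p') (pp' : p^-1 + p'^-1 = 1).
Implicit Types d q s r : R.

Let p0 : 0 < p. Proof. exact: lt_trans p1. Qed.
Let p'0 : 0 < p'. Proof. exact: lt_trans p'1. Qed.

(* For [s := near_optimal_param d q], [1 - s ^+ 2 ~ 2 * d ^+ 2 / q] as [d] tends to
   [0]; among all weights, [1 / p] and [1 / p'] maximise the limit of
   [ratio_test_fun]. *)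
Definition near_optimal_param d q : R := 1 - d ^+ 2 / q.

Lemma near_optimal_param_itv q d : 1 < q -> 0 < d < 1 ->
  -1 < near_optimal_param d q < 1.
Proof.
move=> q1 /andP[d0 d1]; have q0 : 0 < q by apply: lt_trans q1.
have dq0 : 0 < d ^+ 2 / q by rewrite divr_gt0 ?exprn_gt0.
have dq1 : d ^+ 2 / q < 1.
  by rewrite ltr_pdivrMr// mul1r (lt_trans _ q1)// expr_lt1// ltW.
by rewrite /near_optimal_param; apply/andP; split; lra.
Qed.

Lemma near_optimal_paramD d :
  near_optimal_param d p + near_optimal_param d p' = 2 * (1 - d ^+ 2 / 2).
Proof.
transitivity (2 - d ^+ 2 * (p^-1 + p'^-1)); first by rewrite /near_optimal_param; ring.
by rewrite pp'; field.
Qed.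

Lemma sqr_near_optimal_paramB_le d :
  (near_optimal_param d p - near_optimal_param d p') ^+ 2 <= (d ^+ 2) ^+ 2.
Proof.
have -> : near_optimal_param d p - near_optimal_param d p' = d ^+ 2 * (p'^-1 - p^-1).
  by rewrite /near_optimal_param; ring.
have sqr_inv : (p'^-1 - p^-1) ^+ 2 = (p^-1 + p'^-1) ^+ 2 - 4 * (p^-1 * p'^-1) by ring.
rewrite exprMn ler_piMr ?sqr_ge0// sqr_inv pp' expr1n gerBl mulr_ge0//.
by rewrite mulr_ge0// invr_ge0 ltW.
Qed.

Lemma one_sub_sqr_near_optimal_param_ge q d : 1 < q -> 0 < d < 1 ->
  (d * (1 - d)) ^+ 2 * (2 / q) <= 1 - near_optimal_param d q ^+ 2.
Proof.
move=> q1 /andP[d0 d1]; have q0 : 0 < q by apply: lt_trans q1.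
have dq1 : d ^+ 2 / q < d ^+ 2 by rewrite ltr_pdivrMr// ltr_pMr// exprn_gt0.
rewrite /near_optimal_param.
have -> : 1 - (1 - d ^+ 2 / q) ^+ 2 = d ^+ 2 / q * (2 - d ^+ 2 / q) by ring.
have -> : (d * (1 - d)) ^+ 2 * (2 / q) = d ^+ 2 / q * (2 * (1 - d) ^+ 2).
  by field; rewrite gt_eqF.
by rewrite ler_pM2l ?divr_gt0 ?exprn_gt0//; nra.
Qed.

Definition near_optimal_fun d q : 'rV[R[i]]_n -> R[i] :=
  test_fun alpha (near_optimal_param d q).

Lemma ler_inner_near_optimal d : 0 < d < 1 ->
  2 * d ^- n - (d * (1 - d)) ^- n <=
  normc (inner R n alpha (near_optimal_fun d p) (near_optimal_fun d p')).
Proof.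
move=> /andP[d0 d1]; have d1' : 0 < 1 - d by rewrite subr_gt0.
have D0 : 0 < d * (1 - d) by rewrite mulr_gt0.
pose m : R := 1 - d ^+ 2 / 2; pose a := d ^+ 3 / 2; pose c := d / 2.
have am : 0 <= a < 1 - m.
  rewrite /a /m divr_ge0 ?exprn_ge0 ?(ltW d0)//= opprB addrC subrK exprS.
  by rewrite ltr_pM2r// gtr_pMl// exprn_gt0.
have cm : 0 <= c < 1 + m by rewrite /c /m; apply/andP; split; nra.
have sub_le : (near_optimal_param d p - near_optimal_param d p') ^+ 2 <= 4 * a * c.
  rewrite (_ : 4 * a * c = (d ^+ 2) ^+ 2) ?sqr_near_optimal_paramB_le//.
  by rewrite /a /c; field.
apply: le_trans (ler_inner_test_fun n alpha0 (near_optimal_paramD d) am cm sub_le).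
have sqrt_le : Num.sqrt ((1 - m) * (1 + m)) <= d.
  rewrite -[leRHS]gtr0_norm// -sqrtr_sqr ler_wsqrtr// /m -subr_ge0.
  by rewrite (_ : _ - _ = (d ^+ 2 / 2) ^+ 2) ?sqr_ge0//; field.
have sqrt_ge : d * (1 - d) <= Num.sqrt ((1 - m - a) * (1 + m - c)).
  rewrite -[leLHS]gtr0_norm// -sqrtr_sqr ler_wsqrtr// /m /a /c -subr_ge0.
  rewrite (_ : _ - _ = d ^+ 3 * (1 - d) * (3 - d) / 4); last by field.
  by rewrite divr_ge0// ltW// !mulr_gt0 ?exprn_gt0//; lra.
have sqrt0 : 0 < Num.sqrt ((1 - m) * (1 + m)).
  have [/andP[a0 am1] /andP[c0 cm1]] := (am, cm).
  by rewrite sqrtr_gt0 (mulr_gt0 (le_lt_trans a0 am1) (le_lt_trans c0 cm1)).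
by rewrite lerB ?ler_pM2l// ler_invXn.
Qed.

Lemma ratio_test_fun s r : -1 < s < 1 -> -1 < r < 1 ->
  Defs.ratio R n p p' alpha (test_fun alpha s) (test_fun alpha r) =
  normc (inner R n alpha (test_fun alpha s) (test_fun alpha r)) *
  ((1 - s ^+ 2) `^ p^-1 * (1 - r ^+ 2) `^ p'^-1) `^ (n%:R / 2).
Proof.
move=> s1 r1; rewrite /Defs.ratio !pnorm_test_fun//.
by rewrite -invfM invrK [X in _ = _ * X]powRM ?powR_ge0.
Qed.

Lemma Cp_near_optimal_param_le d : 0 < d < 1 ->
  (d * (1 - d)) ^+ 2 * Cp R p p' <=
  (1 - near_optimal_param d p ^+ 2) `^ p^-1 *
  (1 - near_optimal_param d p' ^+ 2) `^ p'^-1.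
Proof.
move=> d01; have /andP[d0 d1] := d01; set D := d * (1 - d).
have D2 : 0 < D ^+ 2 by rewrite exprn_gt0// mulr_gt0// subr_gt0.
have -> : D ^+ 2 * Cp R p p' =
    ((D ^+ 2) `^ p^-1 * (2 / p) `^ p^-1) * ((D ^+ 2) `^ p'^-1 * (2 / p') `^ p'^-1).
  by rewrite [RHS]mulrACA (powR_conjugate pp')// (CpE p0 p'0 pp').
have factor_le q : 1 < q ->
    (D ^+ 2) `^ q^-1 * (2 / q) `^ q^-1 <= (1 - near_optimal_param d q ^+ 2) `^ q^-1.
  move=> q1; have q0 : 0 < q by apply: lt_trans q1.
  have prod_ge0 : 0 <= D ^+ 2 * (2 / q) by rewrite mulr_ge0 ?(ltW D2)// divr_ge0// ltW.
  have sqr_ge := one_sub_sqr_near_optimal_param_ge q1 d01.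
  rewrite -powRM ?(ltW D2) ?divr_ge0 ?(ltW q0)//.
  by apply: ge0_ler_powR; rewrite ?invr_ge0 ?(ltW q0) ?nnegrE// (le_trans prod_ge0).
by rewrite ler_pM ?(mulr_ge0 (powR_ge0 _ _) (powR_ge0 _ _)) ?factor_le.
Qed.

Lemma ler_ratio_near_optimal d : 0 < d < 1 ->
  (2 * (1 - d) ^+ n - 1) * Cp R p p' `^ (n%:R / 2) <=
  Defs.ratio R n p p' alpha (near_optimal_fun d p) (near_optimal_fun d p').
Proof.
move=> d01; have /andP[d0 d1] := d01; pose D := d * (1 - d).
have D0 : 0 < D by rewrite mulr_gt0// subr_gt0.
have C0 := Cp_gt0 p0 p'0 pp'.
have n2 : 0 <= n%:R / 2 :> R by rewrite divr_ge0.
have DC_le : D ^+ n * Cp R p p' `^ (n%:R / 2) <=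
    ((1 - near_optimal_param d p ^+ 2) `^ p^-1 *
     (1 - near_optimal_param d p' ^+ 2) `^ p'^-1) `^ (n%:R / 2).
  have -> : D ^+ n = (D ^+ 2) `^ (n%:R / 2).
    by rewrite -!powR_mulrn ?(ltW D0)// -powRrM mulrC divfK.
  rewrite -powRM ?sqr_ge0 ?(ltW C0)//; apply: (ge0_ler_powR n2).
  - by rewrite nnegrE mulr_ge0 ?sqr_ge0 ?(ltW C0).
  - by rewrite nnegrE (mulr_ge0 (powR_ge0 _ _) (powR_ge0 _ _)).
  - exact: Cp_near_optimal_param_le.
rewrite (ratio_test_fun (near_optimal_param_itv p1 d01)
  (near_optimal_param_itv p'1 d01)).
apply: le_trans (ler_wpM2l (normc_ge0 _) DC_le).
have DC0 : 0 <= D ^+ n * Cp R p p' `^ (n%:R / 2).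
  by rewrite mulr_ge0 ?powR_ge0// exprn_ge0// ltW.
apply: le_trans (ler_wpM2r DC0 (ler_inner_near_optimal d01)).
rewrite mulrA ler_wpM2r ?powR_ge0// -/D mulrBl mulVf ?gt_eqF ?exprn_gt0// lerD2r.
by rewrite /D exprMn -mulrA (mulrA (d ^- n)) mulVf ?mul1r ?gt_eqF ?exprn_gt0.
Qed.

End near_optimal_ratio.

Lemma near_optimal_lower_bound_cvg (R : realType) (n : nat) (c : R) :
  ((2 * (1 - d) ^+ n - 1) * c)%:E @[d --> 0^'+] --> c%:E.
Proof.
apply: cvg_EFin; first exact: nearW.
apply: cvg_at_right_filter.
have cX : (1 - d) ^+ n @[d --> (0 : R)] --> (1 - 0 : R) ^+ n.
  apply: (@continuous_comp R R R (fun d => 1 - d) (fun x => x ^+ n)).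
    by apply: cvgB; [exact: cvg_cst|exact: cvg_id].
  exact: exprn_continuous.
rewrite [X in _ --> X](_ : c = (2 * (1 - 0) ^+ n - 1) * c); last first.
  by rewrite subr0 expr1n; ring.
exact: (cvgM (cvgB (cvgM (cvg_cst _) cX) (cvg_cst _)) (cvg_cst _)).
Qed.

Unset Implicit Arguments.

Theorem theorem1p5 (R : realType) (n : nat) (alpha p p' : R) :
  (0 < n)%N -> 0 < alpha -> 1 < p -> p^-1 + p'^-1 = 1 ->
  ((Cp R p p' `^ (n%:R / 2))%:E <= ereal_sup (EFin @` ratios R n p p' alpha))%E /\
  (ereal_sup (EFin @` ratios R n p p' alpha) <= (Cp R p p' `^ n%:R)%:E)%E.
Proof.
move=> _ alpha0 p1 pp'; have p0 : 0 < p := lt_trans ltr01 p1.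
have pi1 : 0 < p^-1 < 1 by rewrite invr_gt0 p0 invf_lt1.
have p'0 : 0 < p' by rewrite -invr_gt0; lra.
have p'1 : 1 < p' by rewrite -invf_lt1//; lra.
split; last first.
  apply: ge_ereal_sup => _ [_ [g [h [Hg _ Hh _ ->]]] <-].
  rewrite lee_fin powR_mulrn ?(ltW (Cp_gt0 p0 p'0 pp'))//.
  by apply: ratio_le_Cp => //; exact: set_mem.
have lb_cvg := @near_optimal_lower_bound_cvg R n (Cp R p p' `^ (n%:R / 2)).
apply: (cvge_to_le lb_cvg).
near=> d; have d01 : 0 < d < 1.
  by apply/andP; split; near: d; [exact: nbhs_right_gt|exact: nbhs_right_lt].
have lb := ler_ratio_near_optimal n alpha0 p1 p'1 pp' d01; rewrite -lee_fin in lb.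
apply: le_trans lb _; apply: ereal_sup_ubound.
apply: imageP; exists (near_optimal_fun alpha d p), (near_optimal_fun alpha d p').
split=> //; [|exact: cgauss_neq0| |exact: cgauss_neq0].
- exact/mem_set/test_fun_Hspace/near_optimal_param_itv.
- exact/mem_set/test_fun_Hspace/near_optimal_param_itv.
Unshelve. all: by end_near.
Qed.
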